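(* Suppose $\mu$ is a quasistationary probability measure on $\mathfrak F_{[0,1]}$ with $$\mu_{r,t}=\mu_{r,s}\ast\mu_{s,t}\qquad\text{for all }0\le r<s<t\le1.$$ Then $\mu$ is a Poisson process or $\mu=\delta_{[0,1]}$.
   Context: $\mathfrak F_{[0,1]}$ is the space of closed subsets of $[0,1]$ with the Fell topology and its Borel $\sigma$-field. For a probability measure $\mu$ on $\mathfrak F_{[0,1]}$: $\mu_{s,t}$ is its image under $Z\mapsto Z\cap[s,t]$; for $t\in[0,1]$, $\mu+t$ is its image under $Z\mapsto Z+t=(\{z+t:z\in Z\}\cup\{z+t-1:z\in Z\})\cap[0,1]$; $\mu_1\ast\mu_2$ is the image of $\mu_1\otimes\mu_2$ under $(Z_1,Z_2)\mapsto Z_1\cup Z_2$. $\mu$ is quasistationary if $\mu+t$ and $\mu$ are mutually absolutely continuous for all $t\in[0,1]$. A Poisson process is a measure of the form $\Pi_\nu=e^{-\nu([0,1])}\big(\delta_\emptyset+\sum_{n\ge1}\frac1{n!}\int\nu^n(dt_1,\dots,dt_n)\,\delta_{\{t_1,\dots,t_n\}}\big)$ with $\nu$ a finite measure on $[0,1]$ satisfying $\nu(\{t\})=0$ for all $t$. *)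

(* Defs.v *)
From HB Require Import structures.
From mathcomp Require Import all_boot all_order all_algebra.
From mathcomp Require Import all_classical all_reals all_analysis.
Set Implicit Arguments.
Unset Strict Implicit.
Unset Printing Implicit Defensive.
Import Order.TTheory GRing.Theory Num.Theory.
Import numFieldNormedType.Exports.
Local Open Scope classical_set_scope.
Local Open Scope ring_scope.

Section closed_subsets.
Context (X : topologicalType).

Record closed_subset := ClosedSubset {
  cset : set X ;
  csetP : closed cset }.
Arguments csetP : clear implicits.

HB.instance Definition _ := gen_eqMixin closed_subset.
HB.instance Definition _ := gen_choiceMixin closed_subset.

Definition cset0 : closed_subset := ClosedSubset (@closed0 X).
Definition csetT : closed_subset := ClosedSubset (@closedT X).
Definition csetU (Z1 Z2 : closed_subset) : closed_subset :=
  ClosedSubset (closedU (csetP Z1) (csetP Z2)).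

HB.instance Definition _ := isPointed.Build closed_subset cset0.

Definition fell_miss (K : set X) : set closed_subset :=
  [set Z | cset Z `&` K = set0].
Definition fell_hit (G : set X) : set closed_subset :=
  [set Z | cset Z `&` G !=set0].

Definition fell_subbase : set (set closed_subset) :=
  [set fell_miss K | K in @compact X] `|` [set fell_hit G | G in @open X].

HB.instance Definition _ :=
  isSubBaseTopological.Build closed_subset fell_subbase id.

HB.instance Definition _ :=
  Measurable.copy closed_subset (g_sigma_algebraType (@open closed_subset)).

End closed_subsets.
Arguments csetP {X} c.

Section unit_interval.
Context (R : realType).

(* The unit interval with the topology and the Borel sets induced from R. *)
Definition I01 : Type := set_type (`[0%R, 1%R]%classic : set R).

HB.instance Definition _ := Topological.on I01.

Lemma I01_0_subproof : (0 : R) \in (`[0%R, 1%R]%classic : set R).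
Proof. by rewrite inE/= in_itv/= lexx ler01. Qed.

HB.instance Definition _ :=
  isPointed.Build I01 (exist _ (0 : R) I01_0_subproof).

HB.instance Definition _ :=
  Measurable.copy I01 (g_sigma_algebraType (@open I01)).

Definition I01_val (x : I01) : R := set_val x.

Lemma continuous_I01_val : continuous I01_val.
Proof. exact: initial_continuous. Qed.

Lemma hausdorff_I01 : hausdorff_space I01.
Proof.
move=> x y xy; apply/val_inj; apply: (@Rhausdorff R) => A B xA yB.
have [z [Az Bz]] := xy _ _ (continuous_I01_val xA) (continuous_I01_val yB).
by exists (I01_val z).
Qed.

Local Notation closed01 := (closed_subset I01).

Lemma cset_restr_subproof (s t : R) (Z : closed01) :
  closed (cset Z `&` [set x | s <= I01_val x <= t]).
Proof.
apply: closedI; first exact: csetP.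
rewrite (_ : [set _ | _] = I01_val @^-1` `[s, t]).
  apply: closed_comp => [x _|]; first exact: continuous_I01_val.
  exact: itv_closed.
by apply/seteqP; split=> x /=; rewrite in_itv.
Qed.

Definition cset_restr (s t : R) (Z : closed01) : closed01 :=
  ClosedSubset (@cset_restr_subproof s t Z).

Lemma closed_image_I01_val (Z : closed01) : closed (I01_val @` cset Z).
Proof.
have [W oW WZ] : open (~` cset Z) by exact/closed_openC/csetP.
rewrite (_ : I01_val @` cset Z = `[0%R, 1%R]%classic `&` ~` W).
  by apply: closedI; [exact: itv_closed|exact: open_closedC].
apply/seteqP; split=> [_ [z Zz <-]|r [r01 nWr]].
  split; first by have := svalP z; rewrite inE.
  by move=> Wz; have : (~` cset Z) z by rewrite -WZ.
exists (exist _ r (mem_set r01)) => //.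
by apply: contrapT => nZ; apply: nWr;
  have : (~` cset Z) (exist _ r (mem_set r01)) by []; rewrite -WZ.
Qed.

Lemma cset_shift_subproof (t : R) (Z : closed01) :
  closed [set x : I01 | exists2 z, cset Z z &
    I01_val x = I01_val z + t \/ I01_val x = I01_val z + t - 1].
Proof.
rewrite (_ : [set _ | _] =
  (fun x => I01_val x - t) @^-1` (I01_val @` cset Z) `|`
  (fun x => I01_val x - (t - 1)) @^-1` (I01_val @` cset Z)).
  have shiftC (u : R) : continuous (fun x : I01 => I01_val x - u).
    move=> x; apply: (@cvgB _ _ _ (nbhs x)); last exact: cvg_cst.
    exact: continuous_I01_val.
  by apply: closedU; (apply: closed_comp => [x _|];
    [exact: shiftC|exact: closed_image_I01_val]).
apply/seteqP; split=> [x [z Zz [xz|xz]]|x [|] [z Zz zx]].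
- by left; exists z => //=; rewrite xz addrK.
- by right; exists z => //=; rewrite xz -(addrA _ t) addrK.
- by exists z => //; left; rewrite zx subrK.
- by exists z => //; right; rewrite zx -(addrA _ t) subrK.
Qed.

Definition cset_shift (t : R) (Z : closed01) : closed01 :=
  ClosedSubset (@cset_shift_subproof t Z).

Lemma cset_points_subproof n (x : n.-tuple I01) :
  closed [set` (x : seq I01)].
Proof.
have /accessible_finite_set_closed := hausdorff_accessible hausdorff_I01.
by apply; exact: finite_seq.
Qed.

(* The set {x_1, ..., x_n}. *)
Definition cset_points n (x : n.-tuple I01) : closed01 :=
  ClosedSubset (@cset_points_subproof n x).

End unit_interval.

Section measures.
Context (R : realType).
Local Open Scope ereal_scope.
Local Notation closed01 := (closed_subset (I01 R)).
Implicit Types mu : set closed01 -> \bar R.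

(* pushforward, product measure and integral take arbitrary set functions;
   for the Borel measurable maps used below they are the usual ones, and
   measures are to be compared on measurable sets only. *)
Definition same_measure d (T : measurableType d) (m1 m2 : set T -> \bar R) :=
  forall A : set T, measurable A -> m1 A = m2 A.

Definition measure_restr mu (s t : R) : set closed01 -> \bar R :=
  pushforward mu (cset_restr s t).

Definition measure_shift mu (t : R) : set closed01 -> \bar R :=
  pushforward mu (cset_shift t).

Definition measure_conv mu1 mu2 : set closed01 -> \bar R :=
  pushforward (mu1 \x mu2) (fun Z => csetU Z.1 Z.2).

Definition quasistationary mu :=
  forall t : R, (0 <= t <= 1)%R ->
    measure_shift mu t `<< mu /\ mu `<< measure_shift mu t.

Fixpoint measure_pow d (T : measurableType d) (nu : set T -> \bar R) (n : nat) :
    set (n.-tuple T) -> \bar R :=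
  match n with
  | 0 => \d_ [tuple]
  | m.+1 => pushforward (nu \x @measure_pow d T nu m)
              (fun x => [tuple of x.1 :: x.2])
  end.
Arguments measure_pow {d T} nu n A.

Definition poisson_measure (nu : set (I01 R) -> \bar R) : set closed01 -> \bar R :=
  fun A => (expR (- fine (nu setT)))%:E *
    (\d_(cset0 (I01 R)) A +
     \sum_(1 <= n <oo)
       ((n`!%:R)^-1)%:E * \int[measure_pow nu n]_x \d_(cset_points x) A).

Definition poisson_process mu :=
  exists nu : {finite_measure set (I01 R) -> \bar R},
    (forall x : I01 R, nu [set x] = 0) /\
    same_measure mu (poisson_measure nu).

End measures.
Arguments measure_pow {R d T} nu n A.

(* Main.v *)
Require Import Defs.
From HB Require Import structures.
From mathcomp Require Import all_boot all_order all_algebra.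
From mathcomp Require Import finmap lra.
From mathcomp Require Import all_classical all_reals all_analysis.
Set Implicit Arguments.
Unset Strict Implicit.
Unset Printing Implicit Defensive.
Import Order.TTheory GRing.Theory Num.Theory.
Import numFieldNormedType.Exports.
Local Open Scope classical_set_scope.
Local Open Scope ring_scope.

(** The proof goes through the void functional T(K) = mu(Z misses K), for K
closed in [0,1].

The convolution identity on [0,1], cut at s, reads
T(K) = T(K `&` [0,s]) T(K `&` [s,1]), because a union of two sets misses K
exactly when both sets do ([miss_cut01]).  Taking K = {s} gives T({s}) = T({s})^2,
so the event that s lies in Z has probability 0 or 1 ([miss_point01]).
Quasistationarity carries the nullity of this event from one point of ]0,1[ to
all points of [0,1] ([quasistationary_miss_point]), so only two cases remain.

If every point of ]0,1[ belongs almost surely to Z, then so do all rational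
points at once; Z being closed, it is almost surely [0,1] ([all_fixed_full]).

Otherwise no point is charged: T({x}) = 1 for all x, and the cutting identity
holds at every point without boundary corrections ([miss_cut]).  A closed set
that avoids x avoids a neighbourhood of x, hence T([x-d,x+d]) tends to 1 as d
tends to 0 ([miss_near_point]).  With multiplicativity this forces T([0,t]) > 0
for all t: the supremum of the t with this property could always be increased
([miss_le01_gt0]).  So H(t) = - ln T([0,t]) is finite, nondecreasing and
continuous; it is the distribution function of a finite measure nu without
atoms, and T(I) = exp(- nu(I)) for intervals I.  Both sides being
multiplicative under cuts, the formula extends to finite unions of closed
intervals ([poissonian_itvs_itv]).  The Poisson process of intensity nu has the
same void functional ([poisson_measure_miss]).  The events that Z misses a
finite union of closed intervals are stable under intersection and generate the
Borel sets of the Fell topology ([measurable_fellE]), so the two laws agree. *)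

(** * Closed subsets of the unit interval *)

Lemma open_fell_miss (X : topologicalType) (K : set X) :
  compact K -> open (fell_miss K).
Proof.
move=> cK; exists [set fell_miss K]; last by rewrite bigcup_set1.
move=> _ ->; exists [fset fell_miss K]%fset; last by rewrite set_fset1 bigcap_set1.
by move=> A /fset1P ->; apply: mem_set; left; exists K.
Qed.

Lemma fell_missU (X : topologicalType) (K1 K2 : set X) :
  fell_miss (K1 `|` K2) = fell_miss K1 `&` fell_miss K2.
Proof.
apply/seteqP; split=> Z.
  by rewrite /fell_miss/= setIUr setU_eq0.
by rewrite /fell_miss/= => -[Z1 Z2]; rewrite setIUr Z1 Z2 setU0.
Qed.

Lemma fell_miss0 (X : topologicalType) : fell_miss (@set0 X) = setT.
Proof. by apply/seteqP; split=> // Z _; rewrite /fell_miss/= setI0. Qed.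

Section closed_subsets_of_I01.
Context (R : realType).
Local Notation closed01 := (closed_subset (I01 R)).
Implicit Types (K : set (I01 R)) (Z : closed01) (s t x : R) (l : seq (R * R)).

(** The bounds range over all reals: intervals may stick out of [0,1], and the
empty set is itv01 s t for s > t. *)
Definition itv01 (s t : R) : set (I01 R) := [set x | s <= I01_val x <= t].

Definition itvs01 l : set (I01 R) := \big[setU/set0]_(p <- l) itv01 p.1 p.2.

Lemma itvs01_nil : itvs01 [::] = set0.
Proof. exact: big_nil. Qed.

Lemma itvs01_cons p l : itvs01 (p :: l) = itv01 p.1 p.2 `|` itvs01 l.
Proof. exact: big_cons. Qed.

Lemma itvs01_cat l1 l2 : itvs01 (l1 ++ l2) = itvs01 l1 `|` itvs01 l2.
Proof. exact: big_cat. Qed.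

Lemma I01_val_itv (x : I01 R) : 0 <= I01_val x <= 1.
Proof. by have := svalP x; rewrite inE/= in_itv/=. Qed.

Lemma closed_itv01 s t : closed (itv01 s t).
Proof.
rewrite (_ : itv01 s t = @I01_val R @^-1` `[s, t]).
  apply: closed_comp => [x _|]; first exact: continuous_I01_val.
  exact: itv_closed.
by apply/seteqP; split=> x /=; rewrite in_itv.
Qed.

Definition le01 t : set (I01 R) := [set x | I01_val x <= t].

Definition ge01 s : set (I01 R) := [set x | s <= I01_val x].

Lemma le01E t : le01 t = itv01 0 t.
Proof.
apply/seteqP; split=> x; rewrite /itv01/le01/=; last by case/andP.
by move=> ->; have /andP[-> _] := I01_val_itv x.
Qed.

Lemma ge01E s : ge01 s = itv01 s 1.
Proof.
apply/seteqP; split=> x; rewrite /itv01/ge01/=; last by case/andP.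
by move=> ->; have /andP[_ ->] := I01_val_itv x.
Qed.

Lemma closed_le01 t : closed (le01 t).
Proof. by rewrite le01E; exact: closed_itv01. Qed.

Lemma closed_ge01 s : closed (ge01 s).
Proof. by rewrite ge01E; exact: closed_itv01. Qed.

Lemma closed_itvs01 l : closed (itvs01 l).
Proof.
elim: l => [|p l IH]; first by rewrite itvs01_nil; exact: closed0.
by rewrite itvs01_cons; apply: closedU => //; exact: closed_itv01.
Qed.

Lemma itv01_setT s t : s <= 0 -> 1 <= t -> itv01 s t = setT.
Proof.
move=> s0 t1; apply/seteqP; split=> // x _; have /andP[x0 x1] := I01_val_itv x.
by rewrite /itv01/= (le_trans s0 x0) (le_trans x1 t1).
Qed.

Lemma clamp01_subproof (x : R) :
  Num.max 0 (Num.min x 1) \in (`[0%R, 1%R]%classic : set R).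
Proof. by rewrite inE/= in_itv/= le_max lexx/= ge_max ler01 ge_min lexx orbT. Qed.

(** The retraction of the line onto [0,1]; it transfers compactness and
Stieltjes measures from the line. *)
Definition clamp01 (x : R) : I01 R :=
  exist _ (Num.max 0 (Num.min x 1)) (clamp01_subproof x).

Lemma clamp01_val (x : R) : I01_val (clamp01 x) = Num.max 0 (Num.min x 1).
Proof. by []. Qed.

Lemma clamp01K s : 0 <= s <= 1 -> I01_val (clamp01 s) = s.
Proof. by move=> /andP[s0 s1]; rewrite clamp01_val (min_idPl s1) (max_idPr s0). Qed.

Lemma I01_valK : cancel (@I01_val R) clamp01.
Proof.
move=> x; apply/val_inj; rewrite /= -/(I01_val x).
by have /andP[x0 x1] := I01_val_itv x; rewrite (min_idPl x1) (max_idPr x0).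
Qed.

Lemma continuous_clamp01 : continuous clamp01.
Proof.
apply: continuous_comp_initial => x.
have cst_ct (c : R) : {for x, continuous (fun=> c : R^o)} by exact: cvg_cst.
have min_ct : {for x, continuous ((@id R : R -> R^o) \min (fun=> 1 : R^o))}.
  by apply: continuous_min => //; exact: cvg_id.
exact: (continuous_max (cst_ct 0) min_ct).
Qed.

Lemma compact_I01 K : closed K -> compact K.
Proof.
move=> cK; apply: (subclosed_compact cK (B := setT)) => //.
rewrite (_ : setT = clamp01 @` `[0, 1]%classic).
  apply: continuous_compact; last exact: segment_compact.
  exact/continuous_subspaceT/continuous_clamp01.
apply/seteqP; split=> // x _; exists (I01_val x); last exact: I01_valK.
by rewrite /= in_itv/= I01_val_itv.
Qed.

Lemma measurable_fell_miss K : closed K -> measurable (fell_miss K).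
Proof.
move=> cK; apply: sub_sigma_algebra; apply: open_fell_miss.
exact: compact_I01.
Qed.

Lemma measurable_closed01 K : closed K -> measurable K.
Proof.
move=> cK; rewrite -[K]setCK; apply: measurableC.
by apply: sub_sigma_algebra; exact: closed_openC.
Qed.

Lemma cset_restr_miss s t K :
  @cset_restr R s t @^-1` fell_miss K = fell_miss (itv01 s t `&` K).
Proof. by apply/seteqP; split=> Z; rewrite /fell_miss/= setIA. Qed.

End closed_subsets_of_I01.

(** * A generating pi-system for the Fell Borel sets *)

Section fell_pi_system.
Context (R : realType).
Local Notation closed01 := (closed_subset (I01 R)).
Implicit Types (K : set (I01 R)) (Z : closed01) (l : seq (R * R)).

Definition itvs_miss : set (set closed01) :=
  [set fell_miss (itvs01 l) | l in setT].

Lemma setI_closed_itvs_miss : setI_closed itvs_miss.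
Proof.
move=> _ _ [l1 _ <-] [l2 _ <-]; exists (l1 ++ l2) => //.
by rewrite itvs01_cat fell_missU.
Qed.

Let qitv (p : rat * rat) : set (I01 R) := itv01 (ratr p.1) (ratr p.2).

(** Only countably many closed intervals are needed to separate points from
closed sets, which makes the Fell topology second countable. *)
Lemma rat_itv_nbhs (z : I01 R) (A : set (I01 R)) : nbhs z A ->
  exists p : rat * rat,
    [/\ ratr p.1 < I01_val z, I01_val z < ratr p.2 & qitv p `<=` A].
Proof.
move=> [B [[W oW <-] Wz WA]].
have /nbhs_ballP[e /= e0 eW] : nbhs (I01_val z) W by exact: open_nbhs_nbhs.
have [q1 /andP[q1e q1z]] : exists q, ratr q \in `]I01_val z - e, I01_val z[.
  by apply: rat_in_itvoo; rewrite gtrBl.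
have [q2 /andP[q2z q2e]] : exists q, ratr q \in `]I01_val z, I01_val z + e[.
  by apply: rat_in_itvoo; rewrite ltrDl.
rewrite !bnd_simp in q1e q1z q2z q2e.
exists (q1, q2); split=> // x /andP[/= q1x xq2].
apply/WA/eW; rewrite /= /ball/= ltr_distl -/(I01_val x).
by rewrite ltrBlDr -ltrBlDl; lra.
Qed.

(** A test asks whether Z misses, or hits, a given rational interval; tests are
countably many and finite lists of them form a countable family. *)
Let test (e : bool * (rat * rat)) : set closed01 :=
  if e.1 then fell_miss (qitv e.2) else ~` fell_miss (qitv e.2).

Let tests (c : seq (bool * (rat * rat))) : set closed01 :=
  \big[setI/setT]_(e <- c) test e.

Let testsP c Z : tests c Z <-> forall e, e \in c -> test e Z.
Proof.
rewrite /tests -(bigcap_seq c test); split=> [h e ec|h e ec]; exact: h.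
Qed.

(** Hitting an open set is certified by hitting one rational interval inside it;
missing a compact set is certified by missing finitely many rational intervals
that cover it. *)
Lemma fell_subbase_tests (A : set closed01) Z : fell_subbase A -> A Z ->
  exists2 c, tests c Z & tests c `<=` A.
Proof.
case=> [[K cK <-]|[G oG <-]].
  move=> ZK.
  (* Open rational intervals whose closures avoid Z cover K; finitely many do. *)
  pose D := [set p | fell_miss (qitv p) Z].
  pose f (p : rat * rat) : set (I01 R) :=
    [set x | ratr p.1 < I01_val x < ratr p.2].
  move: cK; rewrite compact_cover => /(_ _ D f)[p _||D' D'D KD'].
  - rewrite (_ : f p = @I01_val R @^-1` `]ratr p.1, ratr p.2[).
      by apply: open_comp => [x _|]; [exact: continuous_I01_val|exact: itv_open].
    by apply/seteqP; split=> x /=; rewrite in_itv.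
  - move=> z Kz.
    have /rat_itv_nbhs[p [p1 p2 pZ]] : nbhs z (~` cset Z).
      apply: open_nbhs_nbhs; split; first exact/closed_openC/csetP.
      by move=> Zz; have : (cset Z `&` K) z by []; rewrite ZK.
    exists p; last by rewrite /f/= p1.
    by rewrite /D/= /fell_miss/= setIC; apply/disjoints_subset.
  exists [seq (true, p) | p <- D'].
    by apply/testsP => _ /mapP[p pD' ->]; have /set_mem := D'D _ pD'.
  move=> Y /testsP Yc; apply/seteqP; split=> // x [Yx Kx].
  have [p pD' /andP[px xp]] := KD' _ Kx.
  have /= Yp := Yc _ (map_f (pair true) pD').
  have : (cset Y `&` qitv p) x by split=> //; rewrite /qitv/itv01/= !ltW.
  by rewrite Yp.
move=> [z [Zz Gz]].
have /rat_itv_nbhs[p [p1 p2 pG]] : nbhs z G by exact: open_nbhs_nbhs.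
exists [:: (false, p)]; rewrite /tests big_seq1 /test/=.
  move=> Zp; have : (cset Z `&` qitv p) z.
    by split=> //; rewrite /qitv/itv01/= !ltW.
  by rewrite Zp.
move=> Y /eqP/set0P[y [Yy py]]; exists y; split => //; exact: pG.
Qed.

Lemma fell_open_tests (U : set closed01) Z : open U -> U Z ->
  exists2 c, tests c Z & tests c `<=` U.
Proof.
move=> [D DI <-] [B BD BZ].
have [D' D'sub D'B] := DI _ BD.
suff [c cZ cB] : exists2 c, tests c Z & tests c `<=` B.
  by exists c => // Y /cB YB; exists B.
have {}D'sub : {subset (D' : seq _) <= @fell_subbase (I01 R)} by [].
have {}BZ : forall A, A \in (D' : seq _) -> A Z.
  by move=> A AD'; move: BZ; rewrite -D'B; exact.
have {D'sub BZ}[c cZ cD] : exists2 c, tests c Z &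
    forall A, A \in (D' : seq _) -> tests c `<=` A.
  elim: (D' : seq _) D'sub BZ => [|A s IH] sub sZ.
    by exists [::] => //; exact/testsP.
  have [||c1 c1Z c1s] := IH.
  - by move=> C Cs; apply: sub; rewrite inE Cs orbT.
  - by move=> C Cs; apply: sZ; rewrite inE Cs orbT.
  have /fell_subbase_tests : fell_subbase A.
    by apply/set_mem/sub; rewrite inE eqxx.
  have AZ : A Z by apply: sZ; rewrite inE eqxx.
  move=> /(_ _ AZ)[c2 c2Z c2A].
  have catE : tests (c1 ++ c2) = tests c1 `&` tests c2 by exact: big_cat.
  exists (c1 ++ c2); first by rewrite catE.
  move=> C; rewrite inE catE => /orP[/eqP ->|Cs] Y [Y1 Y2]; first exact: c2A.
  exact: c1s Cs _ Y1.
by exists c => // Y cY; rewrite -D'B => A AD'; exact: cD cY.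
Qed.

(** Every open set is the union of the test sets that it contains, and this union
is countable. *)
Lemma measurable_fellE : @measurable _ closed01 = <<s itvs_miss >>.
Proof.
apply/seteqP; split; last first.
  apply: smallest_sub; first exact: sigma_algebra_measurable.
  by move=> _ [l _ <-]; apply: measurable_fell_miss; exact: closed_itvs01.
apply: smallest_sub; first exact: smallest_sigma_algebra.
move=> U oU.
pose T := g_sigma_algebraType itvs_miss.
have mtest e : measurable (test e : set T).
  rewrite /test; case: ifP => _; last apply: measurableC;
  by apply: sub_sigma_algebra; exists [:: (ratr e.2.1, ratr e.2.2)] => //;
    rewrite itvs01_cons itvs01_nil setU0.
have mtests c : measurable (tests c : set T).
  rewrite /tests; elim/big_ind: _ => [|A B mA mB|e _].
  - exact: (@measurableT _ T).
  - exact: (@measurableI _ T).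
  - exact: mtest.
rewrite (_ : U = \bigcup_c (if asbool (tests c `<=` U) then tests c else set0)).
  apply: (@countable_bigcupT_measurable _ T) => [|c].
    exact: countableP.
  by case: ifP => // _; exact: measurable0.
apply/seteqP; split=> [Z UZ|Z [c _]].
  by have [c cZ cU] := fell_open_tests oU UZ; exists c => //; rewrite asboolT.
by case: asboolP => // cU; exact: cU.
Qed.

Lemma fell_measure_unique (m1 m2 : {measure set closed01 -> \bar R}) :
  (m1 setT < +oo)%E ->
  (forall l, m1 (fell_miss (itvs01 l)) = m2 (fell_miss (itvs01 l))) ->
  same_measure m1 m2.
Proof.
move=> m1oo m12 A mA.
apply: (measure_unique itvs_miss (fun=> setT)) => //.
- exact: measurable_fellE.
- exact: setI_closed_itvs_miss.
- by move=> _; exists [::]; rewrite // itvs01_nil fell_miss0.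
- by rewrite bigcup_const//; exists 0%N.
- by move=> _ [l _ <-].
Qed.

Lemma measurable_fun_fell d (T : measurableType d) (f : T -> closed01) :
  (forall l, measurable (f @^-1` fell_miss (itvs01 l))) ->
  measurable_fun setT f.
Proof.
move=> mf; apply: (measurability _ measurable_fellE).
by move=> _ [_ [l _ <-] <-]; rewrite setTI; exact: mf.
Qed.

Lemma measurable_cset_restr (s t : R) : measurable_fun setT (@cset_restr R s t).
Proof.
apply: measurable_fun_fell => l.
rewrite cset_restr_miss; apply: measurable_fell_miss; apply: closedI.
  exact: closed_itv01.
exact: closed_itvs01.
Qed.

(** Stated as the complement of a finite union, a form from which measurability
of cset_points follows. *)
Lemma cset_points_miss n K :
  @cset_points R n @^-1` fell_miss K =
  ~` \bigcup_(i : 'I_n) ((fun x => tnth x i) @^-1` K).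
Proof.
apply/seteqP; split=> x.
  move=> xK [i _ /= xiK]; have : ([set` x] `&` K) (tnth x i).
    by split=> //; exact: mem_tnth.
  by rewrite [X in X _]xK.
move=> xK; apply/seteqP; split=> // y [/= /tnthP[i ->] ?].
by apply: xK; exists i.
Qed.

Lemma measurable_cset_points n : measurable_fun setT (@cset_points R n).
Proof.
apply: measurable_fun_fell => l; rewrite cset_points_miss.
apply/measurableC/countable_bigcupT_measurable => [|i]; first exact: countableP.
rewrite -[X in measurable X]setTI; apply: measurable_tnth => //.
by apply: measurable_closed01; exact: closed_itvs01.
Qed.

End fell_pi_system.

(** * Poisson processes and their void functional *)

Section pushforward_finite.
Local Open Scope ereal_scope.
Context d d' (T1 : measurableType d) (T2 : measurableType d') (R : realType).

(** The pushforwards in the definition of powers, restrictions and convolutions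
are bare set functions; this packs them as measures. *)
Lemma pushforward_finite_measure (m : {measure set T1 -> \bar R})
    (f : T1 -> T2) : m setT < +oo -> measurable_fun setT f ->
  exists m' : {finite_measure set T2 -> \bar R}, m' = pushforward m f :> (_ -> _).
Proof.
move=> moo mf.
pose pm : {measure set T2 -> \bar R} := HB.pack (pushforward m f).
have mfin : fin_num_fun (pm mf) by exact: lty_fin_num_fun.
pose pfin := @Measure_isFinite.Build _ _ _ (pm mf) mfin.
pose pm' : {finite_measure set T2 -> \bar R} :=
  HB.pack (Measure.sort (pm mf)) pfin.
by exists pm'.
Qed.

End pushforward_finite.

Section measure_powers.
Local Open Scope ereal_scope.
Context d (T : measurableType d) (R : realType).
Variable nu : {finite_measure set T -> \bar R}.

Lemma measure_pow_measure n :
  exists m : {finite_measure set (n.-tuple T) -> \bar R},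
    m = measure_pow nu n :> (_ -> _).
Proof.
elim: n => [|n [m mE]].
  by exists [the {finite_measure set _ -> \bar R} of \d_ [tuple]].
rewrite /= -mE.
apply: pushforward_finite_measure.
  rewrite -setXTT [ltLHS]product_measure1E// lte_mul_pinfty//.
    by rewrite fin_num_measure.
  by rewrite ltey_eq fin_num_measure.
apply: measurable_cons.
  exact: measurable_fst.
exact: measurable_snd.
Qed.

Lemma measurable_cube n (A : set T) : measurable A ->
  measurable [set x : n.-tuple T | forall i, A (tnth x i)].
Proof.
move=> mA; rewrite (_ : mkset _ =
    ~` \bigcup_(i : 'I_n) ((fun x => tnth x i) @^-1` ~` A)).
  apply/measurableC/countable_bigcupT_measurable => [|i]; first exact: countableP.
  rewrite -[X in measurable X]setTI; apply: measurable_tnth => //.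
  exact: measurableC.
apply/seteqP; split=> x/= => [xA [i _ /=]|xA i]; first by apply; exact: xA.
by apply: contrapT => nA; apply: xA; exists i.
Qed.

(** With A the complement of K, this is the mass of the n-tuples that avoid K. *)
Lemma measure_pow_cube n (A : set T) : measurable A ->
  measure_pow nu n [set x | forall i, A (tnth x i)] = nu A ^+ n.
Proof.
move=> mA; elim: n => [|n IH].
  by rewrite expe0 /= diracE mem_set// => -[].
have [m mE] := measure_pow_measure n.
rewrite expeS -IH /= -mE /pushforward.
rewrite (_ : _ @^-1` _ = A `*` [set x : n.-tuple T | forall i, A (tnth x i)]).
  by rewrite product_measure1E//; exact: measurable_cube.
apply/seteqP; split=> [[a x]/= h|[a x]/= [Aa h] i].
  split; first exact: (h ord0).
  by move=> i; have := h (lift ord0 i); rewrite tnthS.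
case: (unliftP ord0 i) => [j ->|->]; last by [].
by rewrite tnthS.
Qed.

End measure_powers.

Section poisson.
Local Open Scope ereal_scope.
Context (R : realType).
Local Notation closed01 := (closed_subset (I01 R)).
Variable nu : {finite_measure set (I01 R) -> \bar R}.

Lemma integral_dirac_cset_points n (A : set closed01) : measurable A ->
  \int[measure_pow nu n]_x \d_(cset_points x) A =
  measure_pow nu n (@cset_points R n @^-1` A).
Proof.
move=> mA; have [m <-] := measure_pow_measure nu n.
have mpA : measurable (@cset_points R n @^-1` A).
  by rewrite -[X in measurable X]setTI; exact: measurable_cset_points.
by rewrite -[X in _ = m X]setIT -integral_indic//.
Qed.

(** The term of index n is the image of nu^n / n! under the map sending a tuple
to the set of its entries. *)
Lemma poisson_measure_measure :
  exists m : {measure set closed01 -> \bar R}, same_measure m (poisson_measure nu).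
Proof.
have scaled_pow n : exists m : {measure set closed01 -> \bar R},
    forall A, m A = ((n`!%:R)^-1)%:E * measure_pow nu n (@cset_points R n @^-1` A).
  have [m mE] := measure_pow_measure nu n.
  have [||m' m'E] := @pushforward_finite_measure _ _ _ _ _ m (@cset_points R n).
  - by rewrite ltey_eq fin_num_measure.
  - exact: measurable_cset_points.
  have c0 : (0 <= (n`!%:R)^-1 :> R)%R by rewrite invr_ge0.
  exists (mscale (NngNum c0) m') => A.
  by rewrite -mE /= /mscale/= m'E.
have c0 := expR_ge0 (- fine (nu setT)).
exists (mscale (NngNum c0) (measure_add (\d_(cset0 (I01 R)))
  (mseries (fun n => projT1 (cid (scaled_pow n))) 1))) => A mA.
apply: (congr1 (mule _)); apply: etrans (measure_addE _ _ _) _.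
congr (_ + _).
apply: eq_eseriesr => n _.
by case: cid => m /= ->; rewrite integral_dirac_cset_points.
Qed.

Lemma nneseries_exp_coeff (x : R) : (0 <= x)%R ->
  \sum_(0 <= n <oo) (x ^+ n / n`!%:R)%:E = (expR x)%:E.
Proof.
move=> x0; rewrite -EFin_lim; last exact: is_cvg_series_exp_coeff.
by congr (limn _); apply/funext => n /=; rewrite /series/= -sumEFin.
Qed.

(** Summing over the number n of points, exp(- nu([0,1])) times the exponential
series at nu(K^c) gives exp(- nu(K)). *)
Lemma poisson_measure_miss K : closed K ->
  poisson_measure nu (fell_miss K) = (expR (- fine (nu K)))%:E.
Proof.
move=> cK; have mK := measurable_closed01 cK.
have mKC := measurableC mK.
have nuKC : nu (~` K) = (fine (nu (~` K)))%:E by rewrite fineK// fin_num_measure.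
rewrite /poisson_measure.
under eq_eseriesr => n _.
  rewrite integral_dirac_cset_points; last exact: measurable_fell_miss.
  rewrite cset_points_miss.
  rewrite (_ : ~` _ = [set x | forall i, (~` K) (tnth x i)]); last first.
    apply/seteqP; split=> x/= => [xA i Ki|xA [i _ /=]]; last exact: xA.
    by apply: xA; exists i.
  rewrite measure_pow_cube// nuKC -EFin_expe -EFinM mulrC.
  over.
rewrite diracE mem_set ?/fell_miss/= ?set0I//.
have -> : 1 + \sum_(1 <= n <oo) (fine (nu (~` K)) ^+ n / n`!%:R)%:E =
    (expR (fine (nu (~` K))))%:E.
  rewrite -nneseries_exp_coeff ?fine_ge0//.
  (* The term of index 0 of the exponential series is the mass of the empty set. *)
  rewrite [RHS](nneseries_split 0 1) ?big_nat1 ?expr0 ?fact0 ?divr1//.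
  by move=> k _; rewrite lee_fin divr_ge0// exprn_ge0// fine_ge0.
rewrite -EFinM -expRD; congr (expR _)%:E.
have -> : nu setT = nu K + nu (~` K) by rewrite -measureU// ?setICr// setUCr.
rewrite fineD ?fin_num_measure//.
by rewrite opprD addrNK.
Qed.
End poisson.

(** * Multiplicativity of the void functional *)

Section void_functional.
Local Open Scope ereal_scope.
Context (R : realType).
Local Notation closed01 := (closed_subset (I01 R)).
Variable mu : probability closed01 R.
Implicit Types (A B K : set (I01 R)) (s t x : R).

Lemma probability_setI1 (E F : set closed01) : measurable E -> measurable F ->
  mu E = 1 -> mu (F `&` E) = mu F.
Proof.
move=> mE mF E1.
have -> : mu F = mu (F `\` E) + mu (F `&` E) by exact: measureDI.
suff -> : mu (F `\` E) = 0 by rewrite add0e.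
apply/eqP; rewrite eq_le measure_ge0 andbT.
have <- : mu (~` E) = 0 by rewrite probability_setC// E1 subee.
by apply: le_measure; rewrite ?inE; [exact: measurableD|exact: measurableC|].
Qed.

Lemma le_miss A B : closed A -> closed B -> A `<=` B ->
  mu (fell_miss B) <= mu (fell_miss A).
Proof.
move=> cA cB AB; apply: le_measure; rewrite ?inE; try exact: measurable_fell_miss.
by move=> Z ZB; apply/seteqP; split=> // z [Zz /AB Bz]; rewrite -ZB.
Qed.

Lemma miss_eq1S A B : closed A -> closed B -> A `<=` B ->
  mu (fell_miss B) = 1 -> mu (fell_miss A) = 1.
Proof.
move=> cA cB AB B1; apply/eqP; rewrite eq_le probability_le1 ?inE//=.
  by rewrite -B1 le_miss.
exact: measurable_fell_miss.
Qed.

(** A set almost surely missed may be added to or removed from K without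
changing the void functional. *)
Lemma miss_eq_mod_null A B K : closed A -> closed B -> closed K ->
  mu (fell_miss K) = 1 -> A `|` K = B `|` K ->
  mu (fell_miss A) = mu (fell_miss B).
Proof.
move=> cA cB cK K1 ABK.
have mK := measurable_fell_miss cK.
rewrite -(probability_setI1 mK (measurable_fell_miss cA) K1).
rewrite -(probability_setI1 mK (measurable_fell_miss cB) K1).
by rewrite -!fell_missU ABK.
Qed.

Hypothesis mu_conv : forall r s t : R,
  (0 <= r)%R -> (r < s)%R -> (s < t)%R -> (t <= 1)%R ->
  same_measure (measure_restr mu r t)
    (measure_conv (measure_restr mu r s) (measure_restr mu s t)).

(** A union of two closed sets misses K exactly when both do, so the product law
of the convolution gives a product of two void probabilities. *)
Lemma miss_cut01 s K : (0 < s < 1)%R -> closed K ->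
  mu (fell_miss K) =
  mu (fell_miss (itv01 0 s `&` K)) * mu (fell_miss (itv01 s 1 `&` K)).
Proof.
move=> /andP[s0 s1] cK.
have restrE (r t : R) : exists m : {finite_measure set closed01 -> \bar R},
    m = measure_restr mu r t :> (_ -> _).
  apply: pushforward_finite_measure; last exact: measurable_cset_restr.
  by rewrite ltey_eq fin_num_measure.
have [m1 m1E] := restrE 0%R s; have [m2 m2E] := restrE s 1%R.
have mK := measurable_fell_miss cK.
have := mu_conv (lexx _) s0 s1 (lexx _) mK.
rewrite /measure_restr {1}/pushforward cset_restr_miss itv01_setT// setTI => ->.
rewrite -/(measure_restr mu 0 s) -/(measure_restr mu s 1) /measure_conv -m1E -m2E.
rewrite /pushforward (_ : _ @^-1` _ = fell_miss K `*` fell_miss K).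
  transitivity (m1 (fell_miss K) * m2 (fell_miss K)).
    exact: product_measure1E.
  rewrite m1E m2E /measure_restr /pushforward.
  by rewrite !cset_restr_miss.
apply/seteqP; split=> -[Z1 Z2]; rewrite /fell_miss/= setIUl.
  by rewrite setU_eq0.
by move=> [-> ->]; rewrite setU0.
Qed.

(** Cutting {s} at s itself leaves {s} on both sides, so its void probability is
idempotent. *)
Lemma miss_point01 s : (0 < s < 1)%R ->
  mu (fell_miss (itv01 s s)) = 0 \/ mu (fell_miss (itv01 s s)) = 1.
Proof.
move=> s01; have /andP[s0 s1] := s01.
have cs := @closed_itv01 R s s.
have := miss_cut01 s01 cs.
have sub (A : set (I01 R)) : itv01 s s `<=` A -> A `&` itv01 s s = itv01 s s.
  by move=> sA; exact/setIidr.
rewrite !sub; [|move=> x /andP[sx xs]..].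
- have : mu (fell_miss (itv01 s s)) \is a fin_num.
    by rewrite fin_num_measure//; exact: measurable_fell_miss.
  move=> /fineK <-; set p := fine _; rewrite -EFinM => -[pp].
  have /eqP : (p * (p - 1) = 0)%R by rewrite mulrBr mulr1 -pp subrr.
  rewrite mulf_eq0 subr_eq0 => /orP[/eqP ->|/eqP ->]; by [left|right].
- by rewrite /itv01/= sx (le_trans xs) ?ltW.
- by rewrite /itv01/= xs (le_trans (ltW s0) sx).
Qed.

Hypothesis miss_point : forall s, mu (fell_miss (itv01 s s)) = 1.

(** When no point is charged, cuts at 0, at 1 and outside [0,1] are harmless too:
one of the two factors is then 1. *)
Lemma miss_cut s K : closed K -> mu (fell_miss K) =
  mu (fell_miss (le01 s `&` K)) *
  mu (fell_miss (ge01 s `&` K)).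
Proof.
move=> cK.
rewrite le01E ge01E.
have cI r t := closedI (@closed_itv01 R r t) cK.
case: (ltrP 0 s) => s0.
  case: (ltrP s 1) => s1; first by apply: miss_cut01 => //; rewrite s0.
  rewrite itv01_setT// setTI (miss_eq1S (cI s 1%R) (@closed_itv01 R s s)) ?mule1//.
  move=> x [/andP[sx x1] _]; rewrite /itv01/= sx/=.
  exact: le_trans x1 s1.
rewrite (@itv01_setT R s 1)// setTI.
rewrite (miss_eq1S (cI 0%R s) (@closed_itv01 R s s)) ?mul1e//.
move=> x [/andP[x0 xs] _]; rewrite /itv01/= xs andbT.
exact: le_trans s0 x0.
Qed.

Lemma miss_le_cut s t : (s <= t)%R ->
  mu (fell_miss (le01 t)) = mu (fell_miss (le01 s)) * mu (fell_miss (itv01 s t)).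
Proof.
move=> st; rewrite (miss_cut s); last exact: closed_le01.
congr (mu (fell_miss _) * mu (fell_miss _)).
  by apply/setIidl => x /le_trans; exact.
by apply/seteqP; split=> x; rewrite /itv01/le01/ge01/= => /andP.
Qed.

(** A closed set without the point x avoids some [x - d, x + d], so the events of
missing these intervals increase to the event of missing x, of probability 1. *)
Lemma miss_near_point x (a : R) : (a < 1)%R -> exists2 d, (0 < d)%R &
  a%:E < mu (fell_miss (itv01 (x - d) (x + d))).
Proof.
move=> a1.
pose I n : set (I01 R) := itv01 (x - n.+1%:R^-1) (x + n.+1%:R^-1).
have cI n : closed (I n) by exact: closed_itv01.
have IE : \bigcup_n fell_miss (I n) = fell_miss (itv01 x x).
  apply/seteqP; split=> [Z [n _ ZI]|Z Zx].
    apply/seteqP; split=> // z [Zz /andP[xz zx]]; rewrite -ZI; split=> //.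
    by rewrite /I /itv01/= lerBlDr (le_trans xz) ?lerDl//= (le_trans zx)// lerDl.
  have /nbhs_ballP[e /= e0 eZ] : nbhs x (~` (@I01_val R @` cset Z)).
    apply: open_nbhs_nbhs; split; first exact/closed_openC/closed_image_I01_val.
    move=> [z Zz zx]; have : (cset Z `&` itv01 x x) z.
      by split=> //; rewrite /itv01/= zx lexx.
    by rewrite Zx.
  have [n ne] : exists n : nat, (n.+1%:R^-1 < e)%R.
    by have [n _ /(_ n (leqnn n))] := near_infty_natSinv_lt (PosNum e0); exists n.
  exists n => //; apply/seteqP; split=> // z [Zz /andP[xz zx]].
  have [] : (~` (@I01_val R @` cset Z)) (I01_val z); last by exists z.
  apply: eZ; rewrite /ball/= ltr_distlC (lt_le_trans _ xz) ?ltrD2l ?ltrN2//=.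
  by rewrite (le_lt_trans zx)// ltrD2l.
have cvg1 : mu \o (fun n => fell_miss (I n)) @ \oo --> 1.
  rewrite -(miss_point x) -IE; apply: nondecreasing_cvg_mu.
  - by move=> n; exact: measurable_fell_miss.
  - by rewrite IE; apply: measurable_fell_miss; exact: closed_itv01.
  - move=> m n mn; apply/subsetPset => Z Zm; apply/seteqP; split=> // z [Zz Iz].
    rewrite -Zm; split=> //; move: Iz; rewrite /I /itv01/= => /andP[xz zx].
    have nm : (n.+1%:R^-1 <= m.+1%:R^-1 :> R)%R by rewrite lef_pV2 ?posrE// ler_nat.
    by rewrite (le_trans _ xz) ?lerD2l ?lerN2//= (le_trans zx)// lerD2l.
apply: contrapT => nd.
have : limn (mu \o (fun n => fell_miss (I n))) <= a%:E.
  apply: lime_le; first by apply/cvg_ex; exists 1.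
  apply: nearW => n /=; rewrite leNgt; apply/negP => aI; apply: nd.
  by exists (n.+1%:R^-1)%R.
by rewrite (cvg_lim _ cvg1)// lee_fin leNgt a1.
Qed.

(** If this failed for some t, the s such that le01 s is missed with positive
probability would have a supremum u.  By multiplicativity this property passes from some s
just below u across a small interval around u to u + d, beyond the supremum. *)
Lemma miss_le01_gt0 t : 0 < mu (fell_miss (le01 t)).
Proof.
have [//|t0] := ltP.
pose S := [set s | 0 < mu (fell_miss (le01 s))].
have supS : has_sup S.
  split; first exists (-1)%R.
    rewrite /S/= (_ : le01 (-1) = set0) ?fell_miss0 ?probability_setT ?lte01//.
    apply/seteqP; split=> // x; rewrite /le01/= => xN.
    have /andP[x0 _] := I01_val_itv x.
    by have := le_trans x0 xN; rewrite oppr_ge0 ler10.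
  exists t => s Ss; rewrite leNgt; apply/negP => ts; move: Ss; apply/negP.
  rewrite -leNgt (le_trans _ t0)// le_miss//; try exact: closed_le01.
  by move=> x; rewrite /le01/= => /le_trans; apply; exact: ltW.
have [d d0 Td] := miss_near_point (sup S) (@ltr01 R).
have [s Ss ds] := sup_adherent d0 supS.
have sS : (s <= sup S)%R by exact: ub_le_sup (proj2 supS) _ Ss.
have : S (sup S + d)%R.
  rewrite /S/= (@miss_le_cut s) ?mule_gt0//; last first.
    by rewrite (le_trans sS)// lerDl ltW.
  apply: lt_le_trans Td _; apply: le_miss; try exact: closed_itv01.
  move=> x; rewrite /itv01/= => /andP[sx ->]; rewrite andbT.
  by rewrite (le_trans _ sx)// ltW.
by move=> /(ub_le_sup (proj2 supS)); rewrite leNgt ltrDl d0.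
Qed.

(** * The intensity measure *)

Definition pmiss K : R := fine (mu (fell_miss K)).

Lemma pmissE K : closed K -> mu (fell_miss K) = (pmiss K)%:E.
Proof.
by move=> cK; rewrite fineK// fin_num_measure//; exact: measurable_fell_miss.
Qed.

(** The cumulative hazard: the distribution function of the intensity. *)
Definition hazard t : R := (- ln (pmiss (le01 t)))%R.

Lemma pmiss_le01_gt0 t : (0 < pmiss (le01 t))%R.
Proof. by rewrite -lte_fin -pmissE ?miss_le01_gt0//; exact: closed_le01. Qed.

Lemma pmiss_le_cut s t : (s <= t)%R ->
  pmiss (le01 t) = (pmiss (le01 s) * pmiss (itv01 s t))%R.
Proof.
move=> st; apply: EFin_inj; rewrite EFinM -!pmissE ?(miss_le_cut st)//.
- exact: closed_itv01.
- exact: closed_le01.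
- exact: closed_le01.
Qed.

Lemma pmiss_itv_gt0 s t : (s <= t)%R -> (0 < pmiss (itv01 s t))%R.
Proof.
move=> st; have := pmiss_le01_gt0 t.
by rewrite (pmiss_le_cut st) pmulr_rgt0 ?pmiss_le01_gt0.
Qed.

Lemma hazardB s t : (s <= t)%R ->
  (hazard t - hazard s = - ln (pmiss (itv01 s t)))%R.
Proof.
move=> st; rewrite /hazard (pmiss_le_cut st).
rewrite lnM ?posrE ?pmiss_itv_gt0 ?pmiss_le01_gt0//.
by rewrite opprK opprD addrAC addNr add0r.
Qed.

Lemma pmiss_le1 K : closed K -> (pmiss K <= 1)%R.
Proof.
move=> cK; rewrite -lee_fin -pmissE//; apply: probability_le1.
exact: measurable_fell_miss.
Qed.

Lemma hazard_nondecreasing : nondecreasing hazard.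
Proof.
move=> s t st; rewrite -subr_ge0 hazardB// oppr_ge0 ln_le0// pmiss_le1//.
exact: closed_itv01.
Qed.

(** Continuity of the hazard function, from the continuity of the void functional
at points.  It gives right-continuity, needed for a Stieltjes measure, and the
absence of atoms. *)
Lemma hazard_near_point x e : (0 < e)%R ->
  exists2 d, (0 < d)%R & (hazard (x + d) - hazard (x - d) < e)%R.
Proof.
move=> e0; have [|d d0] := @miss_near_point x (expR (- e)).
  by rewrite -expR0 ltr_expR oppr_lt0.
have xd : (x - d <= x + d)%R by rewrite lerD2l ge0_cp// ltW.
rewrite pmissE ?lte_fin; last exact: closed_itv01.
move=> ed; exists d => //; rewrite hazardB// ltrNl.
by rewrite -[ltLHS]expRK ltr_ln ?posrE ?expR_gt0// pmiss_itv_gt0.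
Qed.

Lemma hazard_right_continuous : right_continuous hazard.
Proof.
move=> x; apply/cvgrPdist_lt => e e0; have [d d0 de] := hazard_near_point x e0.
near=> t.
have xt : (x <= t)%R by near: t; exact: nbhs_right_ge.
have td : (t <= x + d)%R.
  by near: t; apply: nbhs_right_le; rewrite ltrDl.
have := hazard_nondecreasing td; have := hazard_nondecreasing xt.
have : (hazard (x - d) <= hazard x)%R.
  by apply: hazard_nondecreasing; rewrite gerBl ltW.
move=> h1 h2 h3; rewrite ler0_norm ?subr_le0// opprB.
by lra.
Unshelve. all: by end_near. Qed.

HB.instance Definition _ := isCumulative.Build R _ R hazard
  hazard_nondecreasing hazard_right_continuous.

Lemma hazard0 t : (t < 0)%R -> hazard t = 0%R.
Proof.
move=> t0; rewrite /hazard /pmiss (_ : le01 t = set0).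
  by rewrite fell_miss0 probability_setT ln1 oppr0.
apply/seteqP; split=> // x; rewrite /le01/= => xt.
by have /andP[/le_lt_trans/(_ (le_lt_trans xt t0))] := I01_val_itv x; rewrite ltxx.
Qed.

Lemma hazard_ge1 t : (1 <= t)%R -> hazard t = hazard 1.
Proof.
move=> t1; congr (- ln (pmiss _))%R; apply/seteqP.
split=> x _; have /andP[_ x1] := I01_val_itv x; rewrite /le01//=.
exact: le_trans t1.
Qed.

Let ls_itv s t : (s <= t)%R ->
  lebesgue_stieltjes_measure hazard `]s, t]%classic = (hazard t - hazard s)%:E.
Proof.
move=> st; rewrite /lebesgue_stieltjes_measure /measure_extension.
rewrite measurable_mu_extE/=; last exact: is_ocitv.
by rewrite wlength_itv_bnd.
Qed.

Lemma measurable_clamp01 :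
  measurable_fun setT (@clamp01 R : measurableTypeR R -> I01 R).
Proof.
apply: (measurability (@open (I01 R))) => // _ [U oU <-].
rewrite setTI; apply: (@measurable_realfun.open_measurable R).
by apply: open_comp => // x _; exact: continuous_clamp01.
Qed.

(** The Stieltjes measure of the hazard function, carried to [0,1] by the
retraction.  Restricting it to ]-1, 1] makes its finiteness evident and loses no
mass, since the hazard function is constant below 0 and above 1. *)
Lemma hazard_measure : exists nu : {finite_measure set (I01 R) -> \bar R},
  forall t, nu (le01 t) = (hazard t)%:E.
Proof.
have mD : measurable (`](-1)%R, 1%R]%classic : set (measurableTypeR R)).
  exact: (@measurable_itv R).
pose m : {measure set (measurableTypeR R) -> \bar R} :=
  mrestr (lebesgue_stieltjes_measure hazard) mD.
have mE (A : set (measurableTypeR R)) : m A =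
    lebesgue_stieltjes_measure hazard (A `&` `](-1)%R, 1%R]%classic).
  by [].
have moo : m setT < +oo.
  by rewrite mE setTI ls_itv ?ltry//; lra.
have [nu nuE] := pushforward_finite_measure moo measurable_clamp01.
exists nu => t; rewrite nuE /pushforward mE.
have hN1 : hazard (-1) = 0%R by rewrite hazard0// oppr_lt0.
(* The retraction sends ]-1, 0] to 0, so the set is empty for t < 0 and is all of
   ]-1, 1] for t >= 1. *)
have [t0|t0] := ltP t 0%R.
  rewrite hazard0// (_ : _ `&` _ = set0) ?measure0//.
  apply/seteqP; split=> // x [xt _]; have /andP[x0 _] := I01_val_itv (clamp01 x).
  by have := lt_le_trans t0 x0; rewrite ltNge xt.
have [t1|t1] := ltP t 1%R.
  rewrite (_ : _ `&` _ = `](-1)%R, t%R]%classic).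
    by rewrite ls_itv ?hN1 ?subr0//; lra.
  apply/seteqP; split=> x; rewrite /le01/= clamp01_val ge_max t0 ge_min/=.
    by rewrite [(1 <= t)%R]leNgt t1/= !in_itv/= orbF => -[-> /andP[-> _]].
  rewrite !in_itv/= => /andP[-> xt]; rewrite xt; split=> //=.
  exact: le_trans xt (ltW t1).
rewrite hazard_ge1// (_ : _ `&` _ = `](-1)%R, 1%R]%classic).
  by rewrite ls_itv ?hN1 ?subr0//; lra.
apply/setIidr => x _; rewrite /le01/=.
have /andP[_ /le_trans] := I01_val_itv (clamp01 x).
exact.
Qed.

Section hazard_intensity.
Variable nu : {finite_measure set (I01 R) -> \bar R}.
Hypothesis nu_le01 : forall t, nu (le01 t) = (hazard t)%:E.

Let mle01 t : measurable (le01 t : set (I01 R)).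
Proof. by apply: measurable_closed01; exact: closed_le01. Qed.

Let mitv01 s t : measurable (itv01 s t : set (I01 R)).
Proof. by apply: measurable_closed01; exact: closed_itv01. Qed.

Lemma nu_le01D s t : (s <= t)%R ->
  nu (le01 t `\` le01 s) = (- ln (pmiss (itv01 s t)))%:E.
Proof.
move=> st; rewrite -hazardB// EFinB -!nu_le01 measureD//.
  congr (_ - nu _); apply/setIidr => x; rewrite /le01/= => /le_trans; exact.
by rewrite ltey_eq fin_num_measure.
Qed.

Lemma nu_point s : nu (itv01 s s) = 0.
Proof.
apply/eqP; rewrite eq_le measure_ge0 andbT; apply/lee_addgt0Pr => e e0.
have [d d0 /ltW de] := hazard_near_point s e0; rewrite add0e.
have sd : (s - d <= s + d)%R by rewrite lerD2l ge0_cp// ltW.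
apply: (@le_trans _ _ (nu (le01 (s + d) `\` le01 (s - d)))).
  apply: le_measure; rewrite ?inE//; first exact: measurableD.
  move=> x /andP[sx xs]; split; rewrite /le01/=.
    by rewrite (le_trans xs)// lerDl ltW.
  by apply/negP; rewrite -ltNge (lt_le_trans _ sx)// gtrBl.
by rewrite nu_le01D// -hazardB// lee_fin.
Qed.

(** The counterpart of miss_eq_mod_null for the intensity, which has no atoms.
Both are used to ignore the endpoints of intervals. *)
Lemma nu_eq_mod_point A B s : measurable A -> measurable B ->
  A `|` itv01 s s = B `|` itv01 s s -> nu A = nu B.
Proof.
move=> mA mB AB.
have null : nu.-null_set (itv01 s s) by apply/measure0_null_setP => //; exact: nu_point.
have nuU := (null_setU nu (mitv01 s s)).1 null.
by rewrite -(nuU A mA) AB nuU.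
Qed.

(** * Identification of the void functional *)

Definition poissonian K := pmiss K = expR (- fine (nu K)).

Lemma poissonian0 : poissonian set0.
Proof.
rewrite /poissonian /pmiss fell_miss0 probability_setT.
by rewrite measure0 oppr0 expR0.
Qed.

Lemma poissonian_itv s t : poissonian (itv01 s t).
Proof.
have [st|ts] := leP s t; last first.
  rewrite (_ : itv01 s t = set0); first exact: poissonian0.
  apply/seteqP; split=> // x /andP[sx xt]; have := le_lt_trans xt ts.
  by rewrite ltNge sx.
rewrite /poissonian (_ : nu _ = nu (le01 t `\` le01 s)).
  by rewrite nu_le01D// opprK lnK// posrE pmiss_itv_gt0.
apply: (@nu_eq_mod_point _ _ s) => //; first exact: measurableD.
apply/seteqP; split=> x; rewrite /itv01/le01/ge01/=.
  move=> [/andP[sx xt]|]; last by right.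
  have [xs|xs] := leP (I01_val x) s; first by right; rewrite sx.
  by left; split=> //; apply/negP; rewrite -ltNge.
move=> [[xt /negP]|]; last by right.
by rewrite -ltNge => /ltW ->; left.
Qed.

Lemma poissonian_mod_point A B s : closed A -> closed B ->
  A `|` itv01 s s = B `|` itv01 s s -> poissonian A -> poissonian B.
Proof.
move=> cA cB AB; rewrite /poissonian => pA.
have -> : pmiss B = pmiss A.
  congr fine; apply: (miss_eq_mod_null (K := itv01 s s)) => //.
  exact: closed_itv01.
by rewrite pA; congr (expR (- fine _))%R; apply: nu_eq_mod_point AB;
  exact: measurable_closed01.
Qed.

(** Both sides of the defining equation are multiplicative under a cut at s, the
right one because s has intensity 0. *)
Lemma poissonian_cut K s : closed K ->
  poissonian (le01 s `&` K) -> poissonian (ge01 s `&` K) ->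
  poissonian K.
Proof.
move=> cK; rewrite /poissonian => K1 K2.
have c1 := closedI (@closed_le01 R s) cK; have c2 := closedI (@closed_ge01 R s) cK.
have -> : pmiss K = (pmiss (le01 s `&` K) * pmiss (ge01 s `&` K))%R.
  by apply: EFin_inj; rewrite EFinM -!pmissE//; exact: miss_cut.
rewrite K1 K2 -expRD -opprD -fineD ?fin_num_measure//; try exact: measurable_closed01.
congr (expR (- fine _))%R.
have mK := measurable_closed01 cK.
have <- : nu (K `\` le01 s) = nu (ge01 s `&` K).
  apply: (@nu_eq_mod_point _ _ s).
  - exact: measurableD.
  - exact: measurable_closed01.
  apply/seteqP; split=> x; rewrite /itv01/le01/ge01/=.
    move=> [[Kx /negP]|]; last by right.
    by rewrite -ltNge => /ltW sx; left.
  move=> [[sx Kx]|]; last by right.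
  have [xs|xs] := leP (I01_val x) s; first by right; rewrite sx.
  by left; split=> //; apply/negP; rewrite -ltNge.
by rewrite setIC addeC; exact/esym/measureDI.
Qed.

(** By induction on the list of intervals: cutting at the endpoints of the first
interval [a,b] separates K into an interval and two pieces where, up to the
points a and b, only the other intervals matter.  The extra interval [s,t] is
what makes the induction hypothesis apply to these pieces. *)
Lemma poissonian_itvs_itv l s t : poissonian (itvs01 l `&` itv01 s t).
Proof.
elim: l s t => [|[a b] l IH] s t.
  by rewrite itvs01_nil set0I; exact: poissonian0.
have cI r u l' := closedI (@closed_itvs01 R l') (@closed_itv01 R r u).
have [ab|ba] := leP a b; last first.
  rewrite itvs01_cons (_ : itv01 _ _ = set0) ?set0U; first exact: IH.
  apply/seteqP; split=> // x /andP[/= ax xb]; have := le_lt_trans xb ba.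
  by rewrite ltNge ax.
rewrite itvs01_cons; have tT : true by []; have nF : ~ false by [].
have cK : closed ((itv01 a b `|` itvs01 l) `&` itv01 s t).
  by rewrite -[_ `|` _](itvs01_cons (a, b) l); exact: cI.
(* On the left of a only the other intervals remain, apart from the point a. *)
apply: (@poissonian_cut _ a) => //.
  apply: (poissonian_mod_point (s := a) _ _ _ (IH s (Num.min t a))) => //.
    by apply: closedI => //; exact: closed_le01.
  apply/seteqP; split=> x; rewrite /itv01/le01/ge01/= le_min;
    by case: (ltgtP (I01_val x) a) => /= _; rewrite ?andbT ?andbF; tauto.
have cK' := closedI (@closed_ge01 R a) cK.
(* Between a and b the set is a single interval. *)
apply: (@poissonian_cut _ b) => //.
  rewrite (_ : _ `&` _ = itv01 (Num.max s a) (Num.min t b)).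
    exact: poissonian_itv.
  apply/seteqP; split=> x; rewrite /itv01/le01/ge01/= le_min ge_max.
    by move=> [-> [-> [_ /andP[-> ->]]]].
  by move=> /andP[/andP[-> ->] /andP[-> ->]]; split=> //; split=> //; split=> //; left.
apply: (poissonian_mod_point (s := b) _ _ _ (IH (Num.max s b) t)) => //.
  by apply: closedI => //; exact: closed_ge01.
apply/seteqP; split=> x; rewrite /itv01/le01/ge01/= ge_max; move: ab.
  by case: (ltgtP (I01_val x) b) => /= [_ _|bx ab|-> ab];
    rewrite ?andbT ?andbF ?(le_trans ab (ltW bx)); tauto.
by case: (ltgtP (I01_val x) b) => /= [_ _|bx ab|-> ab];
  rewrite ?andbT ?andbF ?(le_trans ab (ltW bx)); tauto.
Qed.

Lemma poissonian_poisson_process : poisson_process mu.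
Proof.
exists nu; split=> [x|].
  rewrite (_ : [set x] = itv01 (I01_val x) (I01_val x)); first exact: nu_point.
  apply/seteqP; split=> y /=; rewrite /itv01/=; first by move=> ->; rewrite lexx.
  by move=> /le_anti xy; apply: val_inj; exact: esym xy.
have [m mE] := poisson_measure_measure nu.
move=> A mA; rewrite -mE//; move: A mA.
apply: fell_measure_unique => [|l]; first by rewrite [ltLHS](probability_setT mu) ltry.
have cl := @closed_itvs01 R l.
rewrite mE; last exact: measurable_fell_miss.
rewrite poisson_measure_miss//; apply: etrans (pmissE cl) _; congr _%:E.
by have := poissonian_itvs_itv l 0 1; rewrite itv01_setT// setIT.
Qed.

End hazard_intensity.

Lemma no_fixed_point_poisson : poisson_process mu.
Proof.
by have [nu nuE] := hazard_measure; exact: poissonian_poisson_process nuE.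
Qed.

End void_functional.

(** * Points charged by the random set *)

Section fixed_points.
Local Open Scope ereal_scope.
Context (R : realType).
Local Notation closed01 := (closed_subset (I01 R)).
Variable mu : probability closed01 R.
Implicit Types (Z : closed01) (s t x : R).

Lemma miss_null_hit s :
  mu (~` fell_miss (itv01 s s)) = 0 <-> mu (fell_miss (itv01 s s)) = 1.
Proof.
have ms : measurable (fell_miss (itv01 s s)).
  by apply: measurable_fell_miss; exact: closed_itv01.
split=> h; last by rewrite probability_setC// h subee.
by rewrite -[fell_miss _]setCK probability_setC ?h ?sube0//; exact: measurableC.
Qed.

(** Under the cyclic shift by t, a point lands on s from s - t or from s - t + 1;
at most one of them lies in [0,1], except when they are 0 and 1. *)
Lemma cset_shift_hit s t : (0 <= s <= 1)%R ->
  @cset_shift R t @^-1` (~` fell_miss (itv01 s s)) =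
    ~` fell_miss (itv01 (s - t) (s - t)) `|`
    ~` fell_miss (itv01 (s - t + 1) (s - t + 1)).
Proof.
move=> /clamp01K s01.
have hitE u Z : (~` fell_miss (itv01 u u)) Z <->
    exists2 z, cset Z z & I01_val z = u.
  split=> [/eqP/set0P[z [Zz /le_anti uz]]|[z Zz zu] Zu]; first by exists z.
  have : (cset Z `&` itv01 u u) z by split=> //; rewrite /itv01/= zu lexx.
  by rewrite Zu.
apply/seteqP; split=> Z.
  move=> /hitE[x [z Zz [xz|xz]] xs]; [left|right]; apply/hitE; exists z => //; lra.
move=> ZH; apply/hitE; exists (clamp01 s) => //.
by case: ZH => /hitE[z Zz zs]; exists z => //; [left|right]; rewrite s01 zs; lra.
Qed.

(** Given x in [0,1], one of the shifts by s - x and by s - x + 1 is allowed, and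
either brings x to s.  So if Z almost surely avoids s, then, shifted sets
having the same null events, it almost surely avoids x. *)
Lemma quasistationary_miss_point s : quasistationary mu -> (0 <= s <= 1)%R ->
  mu (fell_miss (itv01 s s)) = 1 -> forall x, mu (fell_miss (itv01 x x)) = 1.
Proof.
move=> qs s01 s1 x.
have mhit u : measurable (~` fell_miss (@itv01 R u u)).
  by apply: measurableC; apply: measurable_fell_miss; exact: closed_itv01.
have shift0 t : (0 <= t <= 1)%R ->
    mu (~` fell_miss (itv01 (s - t) (s - t)) `|`
        ~` fell_miss (itv01 (s - t + 1) (s - t + 1))) = 0.
  move=> t01; rewrite -cset_shift_hit//; have [+ _] := qs t t01.
  have null : mu.-null_set (~` fell_miss (itv01 s s)).
    by apply/measure0_null_setP => //; exact/miss_null_hit.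
  by move=> /(_ _ null _ (mhit s) (fun=> id)).
have null_sub u t : (0 <= t <= 1)%R ->
    ~` fell_miss (itv01 u u) `<=` ~` fell_miss (itv01 (s - t) (s - t)) `|`
        ~` fell_miss (itv01 (s - t + 1) (s - t + 1)) ->
    mu (fell_miss (itv01 u u)) = 1.
  move=> t01 ut; apply/miss_null_hit/eqP; rewrite eq_le measure_ge0 andbT.
  by rewrite -(shift0 t t01) le_measure// inE; [exact: mhit|exact: measurableU].
have [x01|x01] := boolP (0 <= x <= 1)%R; last first.
  rewrite (_ : itv01 x x = set0) ?fell_miss0 ?probability_setT//.
  apply/seteqP; split=> // z /le_anti xz; move/negP: x01; apply.
  by rewrite xz I01_val_itv.
have [xs|xs] := leP x s.
  apply: (null_sub x (s - x)%R); first lra.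
  by rewrite opprB addrC subrK; left.
apply: (null_sub x (s - x + 1)%R); first lra.
by rewrite opprD opprB addrA (addrC s) subrK subrK; right.
Qed.

Lemma fell_full Z :
  (forall q : rat, (0 < (ratr q : R) < 1)%R ->
    ~ fell_miss (itv01 (ratr q : R) (ratr q)) Z) -> Z = csetT (I01 R).
Proof.
move=> Zq; suff ZT : cset Z = setT.
  case: Z {Zq} ZT => Z cZ /= ZT; subst Z.
  by congr ClosedSubset; exact: Prop_irrelevance.
apply/seteqP; split=> // x _; apply: contrapT => nZx.
have /rat_itv_nbhs[p [p1 p2 pZ]] : nbhs x (~` cset Z).
  by apply: open_nbhs_nbhs; split=> //; exact/closed_openC/csetP.
have /andP[x0 x1] := I01_val_itv x.
(* The neighbourhood may stick out of ]0,1[ when x is 0 or 1, but still meets it. *)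
have [q] : exists q : rat,
    ratr q \in `]Num.max (ratr p.1) (0 : R), Num.min (ratr p.2) 1[%R.
  apply: rat_in_itvoo; rewrite gt_max !lt_min.
  by rewrite (lt_trans p1 p2) (lt_le_trans p1 x1) (le_lt_trans x0 p2) ltr01.
rewrite in_itv/= gt_max lt_min => /andP[/andP[p1q q0] /andP[qp2 q1]].
apply: (Zq q); first by rewrite q0.
apply/seteqP; split=> // z [Zz /andP[qz zq]]; apply: (pZ z) Zz.
by rewrite /itv01/= (le_trans (ltW p1q) qz) (le_trans zq (ltW qp2)).
Qed.

(** Almost surely Z contains all rational points, hence is full. *)
Lemma all_fixed_full :
  (forall s, (0 < s < 1)%R -> mu (fell_miss (itv01 s s)) = 0) ->
  same_measure mu (\d_(csetT (I01 R))).
Proof.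
move=> miss0.
(* The events that Z misses the n-th rational point of ]0,1[, in the enumeration
   of the rationals. *)
pose F n : set closed01 := if choice.unpickle n is Some q then
  if (0 < (ratr q : R) < 1)%R then fell_miss (itv01 (ratr q) (ratr q)) else set0
  else set0.
have mmiss s : measurable (fell_miss (@itv01 R s s)).
  by apply: measurable_fell_miss; exact: closed_itv01.
have mF n : measurable (F n).
  by rewrite /F; case: choice.unpickle => // q; case: ifP => // _.
have mUF : measurable (\bigcup_n F n) by exact: bigcupT_measurable.
have F0 : mu (\bigcup_n F n) = 0.
  apply: measure_negligible => //; apply: negligible_bigcup => n.
  apply/negligibleP => //; rewrite /F; case: choice.unpickle => [q|]; last exact: measure0.
  by case: ifP => [q01|_]; [exact: miss0|exact: measure0].
have nF Z : ~ (\bigcup_n F n) Z -> Z = csetT (I01 R).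
  move=> nFZ; apply: fell_full => q q01 Zq; apply: nFZ.
  by exists (choice.pickle q) => //; rewrite /F choice.pickleK q01.
have FT : ~ (\bigcup_n F n) (csetT (I01 R)).
  move=> [n _]; rewrite /F; case: choice.unpickle => // q; case: ifP => // /andP[q0 q1].
  move=> h; have : (setT `&` itv01 (ratr q) (ratr q)) (clamp01 (ratr q : R)).
    by split=> //; rewrite /itv01/= clamp01K ?lexx// (ltW q0) ltW.
  by rewrite [X in X _]h.
move=> A mA; rewrite diracE.
have le0 (B : set closed01) : measurable B -> B `<=` \bigcup_n F n -> mu B = 0.
  move=> mB BF; apply/eqP; rewrite eq_le measure_ge0 andbT -F0.
  by apply: le_measure; rewrite ?inE.
case: (boolP (_ \in A)) => [/set_mem TA|/negP TA].
  rewrite -[A]setCK probability_setC; last exact: measurableC.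
  rewrite le0 ?sube0//; first exact: measurableC.
  by move=> Z nAZ; apply: contrapT => /nF ZT; apply: nAZ; rewrite ZT.
rewrite le0// => Z AZ; apply: contrapT => /nF ZT; apply: TA.
by rewrite -ZT inE.
Qed.

End fixed_points.

Theorem proposition4p6 (R : realType)
    (mu : probability (closed_subset (I01 R)) R)
    (mu_qs : quasistationary mu)
    (mu_conv : forall r s t : R, 0 <= r -> r < s -> s < t -> t <= 1 ->
      same_measure (measure_restr mu r t)
        (measure_conv (measure_restr mu r s) (measure_restr mu s t))) :
  poisson_process mu \/ same_measure mu (\d_(csetT (I01 R))).
Proof.
have half01 : 0 < (2^-1 : R) < 1 by lra.
have [h0|h1] := miss_point01 mu_conv half01; [right|left].
  apply: all_fixed_full => s s01.
  have [//|s1] := miss_point01 mu_conv s01.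
  have s01' : 0 <= s <= 1 by lra.
  have := quasistationary_miss_point mu_qs s01' s1 2^-1.
  by rewrite h0 => /eqP; rewrite eqe eq_sym oner_eq0.
apply: (no_fixed_point_poisson mu_conv).
apply: (quasistationary_miss_point mu_qs _ h1); lra.
Qed.
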